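(* Consider the bilinear system \[ \dot x(t) = Ax(t) + Bu(t) + \sum_{k=1}^m N_k x(t) u_k(t),\qquad y(t) = Cx(t),\quad t\ge 0, \] with $A, N_k\in\mathbb R^{n\times n}$, $B\in\mathbb R^{n\times m}$, $C\in\mathbb R^{p\times n}$, $u\in L^2$, and assume \[ \sigma\Big(A\otimes I+I\otimes A+ \sum_{k=1}^m N_k \otimes N_k\Big)\subset \mathbb C_- . \] Assume the realization $(A,B,C,N_k)$ is balanced, i.e. $P=Q=\Sigma=\operatorname{diag}(\sigma_1,\ldots,\sigma_n)>0$, where $P$ and $Q$ solve \[ A P + P A^T + \sum_{k=1}^m N_k P N_k^T = - B B^T,\qquad A^T Q + Q A + \sum_{k=1}^m N_k^T Q N_k = - C^T C, \] and partition \[ A=\begin{pmatrix}A_{11}&A_{12}\\ A_{21}&A_{22}\end{pmatrix},\ B=\begin{pmatrix}B_1\\ B_2\end{pmatrix},\ C=\begin{pmatrix}C_1& C_2\end{pmatrix},\ N_k=\begin{pmatrix}N_{k,11}&N_{k,12}\\ N_{k,21}&N_{k,22}\end{pmatrix},\ \Sigma=\begin{pmatrix}\Sigma_1&\\ &\Sigma_2\end{pmatrix}, \] with $A_{11}\in\mathbb R^{r\times r}$, $\Sigma_1\in\mathbb R^{r\times r}$, $\Sigma_2=\operatorname{diag}(\sigma_{r+1},\ldots,\sigma_n)$. Let $\hat y$ be the output of the reduced bilinear system $\dot{\hat x}=\hat A\hat x+\hat B u+\sum_{k=1}^m \hat N_k\hat x u_k$, $\hat y=\hat C\hat x$ with the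 balanced truncation matrices $(\hat A,\hat B,\hat C,\hat N_k)=(A_{11},B_1,C_1,N_{k,11})$. Then, with zero initial conditions for both the full and the reduced system, \[ \sup_{t\geq 0}\left\|y(t)-\hat y(t)\right\|_2 \leq \left(\operatorname{tr}(\Sigma_2 K_{BT})\right)^{\frac{1}{2}} \exp\left\{0.5\left\|u^{0}\right\|_{L^2}^2\right\} \left\|u\right\|_{L^2}, \] where \[ K_{BT} = B_2 B_2^T+2 P_{g,2}A_{21}^T +\sum_{k=1}^m \big(2 N_{k,22} P_{g,2}N_{k,21}^T+2 N_{k,21} P_{g,1}N_{k,21}^T-N_{k,21} \hat P N_{k,21}^T\big), \] $\hat P$ solves $\hat A \hat P + \hat P \hat A^T + \sum_{k=1}^m \hat N_k \hat P \hat N_k^T = - \hat B \hat B^T$, and $P_g=\begin{pmatrix}P_{g,1}\\ P_{g,2}\end{pmatrix}$ (with $P_{g,1}\in\mathbb R^{r\times r}$) solves $A P_g + P_g \hat A^T + \sum_{k=1}^m N_k P_g \hat N_k^T = - B \hat B^T$.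
   Context: Here $\|u\|_{L^2}^2=\int_0^\infty u^T(s)u(s)\,ds$, and $u^0=(u^0_1,\ldots,u^0_m)^T$ is the vector of control components with nonzero $N_k$: $u^0_k\equiv 0$ if $N_k=0$ and $u^0_k=u_k$ otherwise. $\mathbb C_-$ denotes the open left half complex plane. *)

(* Defs.v *)
From mathcomp Require Import all_boot all_order all_algebra.
From mathcomp Require Import all_classical all_reals all_analysis.
Set Implicit Arguments. Unset Strict Implicit. Unset Printing Implicit Defensive.
Import Order.TTheory GRing.Theory Num.Theory.
From mathcomp Require Import complex mxtens.
Local Open Scope ring_scope.
Local Open Scope classical_set_scope.

Section Defs.
Variable R : realType.

Definition spec_in_Cminus (d : nat) (M : 'M[R]_d) : Prop :=
  forall z : R[i], eigenvalue (map_mx (fun a : R => (a%:C)%C) M) z -> complex.Re z < 0.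

Definition lyap_kron (n m : nat) (A : 'M[R]_n) (N : 'I_m -> 'M[R]_n) : 'M[R]_(n * n) :=
  A *t (1%:M : 'M[R]_n) + (1%:M : 'M[R]_n) *t A + \sum_(k < m) (N k *t N k).

Definition itv0 (t : R) : set R := [set s | 0 <= s <= t].
Definition halfline : set R := [set s | 0 <= s].

(* x is a (Caratheodory) solution with x(0)=0 of
   x' = A x + B u + sum_k N_k x u_k on [0, +oo), written as the integral equation
   x(t) = int_0^t (A x(s) + B u(s) + sum_k N_k x(s) u_k(s)) ds, componentwise. *)
Definition bilinear_sol (n m : nat) (A : 'M[R]_n) (B : 'M[R]_(n, m))
  (N : 'I_m -> 'M[R]_n) (u : R -> 'cV[R]_m) (x : R -> 'cV[R]_n) : Prop :=
  forall t, 0 <= t -> forall i : 'I_n,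
    let f := fun s => (A *m x s + B *m u s + \sum_(k < m) (u s k 0) *: (N k *m x s)) i 0 in
    (@lebesgue_measure R).-integrable (itv0 t) (EFin \o f) /\
    x t i 0 = Rintegral (@lebesgue_measure R) (itv0 t) f.

Definition in_L2 (m : nat) (u : R -> 'cV[R]_m) : Prop :=
  forall k : 'I_m,
    measurable_fun halfline (fun s => u s k 0) /\
    (\int[@lebesgue_measure R]_(s in halfline) ((u s k 0) ^+ 2)%:E < +oo)%E.

(* sum over the components k with S k of  int_0^oo u_k(s)^2 ds ;
   with S = predT this is ||u||_{L^2}^2, with S k = (N_k != 0) it is ||u^0||_{L^2}^2 *)
Definition L2sq_sub (m : nat) (S : pred 'I_m) (u : R -> 'cV[R]_m) : R :=
  \sum_(k < m | S k) fine (\int[@lebesgue_measure R]_(s in halfline) ((u s k 0) ^+ 2)%:E)%E.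

Definition eucl (p : nat) (v : 'cV[R]_p) : R := Num.sqrt (\sum_(i < p) (v i 0) ^+ 2).

End Defs.

(* Main.v *)
Require Import Defs.
From mathcomp Require Import all_boot all_order all_algebra.
From mathcomp Require Import all_classical all_reals all_analysis.
Import Order.TTheory GRing.Theory Num.Theory.
From mathcomp Require Import complex mxtens.
From HB Require Import structures.
From mathcomp Require Import measurable_realfun lra ring.
Local Open Scope ring_scope.

(** The error [y - yhat] is the output of the bilinear system with state
    [(x, xhat)] and block-diagonal coefficients, so it is enough to bound the
    output of one system [(A, B, C, N)].  Let [L(X) = A X + X A^T + sum_k N_k X N_k^T].
    If [X] is positive definite with [L(X) <= - B B^T], then [V = x^T X^-1 x]
    satisfies [V' <= |u|^2 + |u^0|^2 V]: writing [z = X^-1 x], the quadratic form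
    of [L(X) + B B^T] at [z] absorbs [2 z^T B u] and [2 u_k z^T N_k X z].
    Gronwall gives [V <= exp(|u^0|^2) |u|^2], and [|C x|^2 <= tr(C X C^T) V].

    The Gramian [P] of the error system cannot be used as [X]: the reduced system may be
    only marginally stable, and [P] is then neither unique nor semidefinite in
    general.  Instead [A] is replaced by [A - e/2], giving [L_e = L - e], which is
    strictly stable because [L_e(W) < 0] for [W = diag(Sigma, Sigma_1)]; then [L_e(X) = - B B^T] and
    [L_e^*(Y) = - C^T C] are solvable with [X, Y >= 0] and [Y] bounded
    independently of [e].  By duality [tr(C X C^T) = tr(C P C^T) - e tr(Y P)], and
    [e] tends to 0.  Finally [tr(C P C^T) = tr(Sigma_2 K)] for the error system. *)

(** * Absolutely continuous functions and Gronwall's inequality *)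

Section Primitives.
Import numFieldNormedType.Exports.
Local Open Scope classical_set_scope.
Variable R : realType.
Notation mu := (@lebesgue_measure R).
Implicit Types (T : R) (f g F G : R -> R).

(** Absolute continuity of [F] on [[0, T]] with [F 0 = 0], stated through its density [f]. All later
    arguments use increments of [F] only, so no almost everywhere derivative has to be taken. *)
Definition primitive_on T f F : Prop :=
  mu.-integrable `[0, T] (EFin \o f) /\
  forall t, 0 <= t -> t <= T -> F t = \int[mu]_(s in `[0, t]) f s.

Lemma primitive_sub {T f F a b} : primitive_on T f F -> 0 <= a -> b <= T ->
  mu.-integrable `[a, b] (EFin \o f).
Proof.
move=> [fi _] a0 bT; apply: integrableS fi => //.
by apply: subset_itv; rewrite bnd_simp.
Qed.

Lemma primitive_incr {T f F a b} : primitive_on T f F ->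
  0 <= a -> a <= b -> b <= T -> F b - F a = \int[mu]_(s in `[a, b]) f s.
Proof.
move=> fF a0 ab bT; have [fi FE] := fF.
rewrite !FE ?(le_trans ab)// ?(le_trans a0)//.
rewrite Rintegral_itvB ?bnd_simp//; last exact: primitive_sub fF _ _.
rewrite Rintegral_itv_obnd_cbnd//.
by apply: (@integrableS _ _ _ mu `[a, b]) => //;
  [exact: subset_itv_oc_cc|exact: primitive_sub fF _ _].
Qed.

Lemma primitive0 {T f F} : 0 <= T -> primitive_on T f F -> F 0 = 0.
Proof. by move=> T0 [_ ->//]; rewrite set_itv1 Rintegral_set1. Qed.

Lemma primitive_le {T f F g G a b} : primitive_on T f F -> primitive_on T g G ->
  (forall s, a <= s -> s <= b -> f s <= g s) ->
  0 <= a -> a <= b -> b <= T -> F b - F a <= G b - G a.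
Proof.
move=> fF gG fg a0 ab bT; rewrite (primitive_incr fF)// (primitive_incr gG)//.
apply: le_Rintegral => //; [exact: primitive_sub fF _ _|exact: primitive_sub gG _ _|].
by move=> s /=; rewrite in_itv/= => /andP[as_ sb]; apply: fg; lra.
Qed.

Lemma primitive_mono {T g G a b} : primitive_on T g G ->
  (forall s, a <= s -> s <= b -> 0 <= g s) ->
  0 <= a -> a <= b -> b <= T -> G a <= G b.
Proof.
move=> gG g0 a0 ab bT; rewrite -subr_ge0 (primitive_incr gG)//.
apply: Rintegral_ge0.
by move=> s /=; rewrite in_itv/= => /andP[as_ sb]; apply: g0; lra.
Qed.

Lemma primitive_norm_le {T f F g G a b} : primitive_on T f F -> primitive_on T g G ->
  (forall s, a <= s -> s <= b -> `|f s| <= g s) ->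
  0 <= a -> a <= b -> b <= T -> `|F b - F a| <= G b - G a.
Proof.
move=> fF gG fg a0 ab bT; rewrite (primitive_incr fF)// (primitive_incr gG)//.
have fi := primitive_sub fF a0 bT.
apply: (le_trans (le_normr_Rintegral _ _)) => //.
apply: le_Rintegral => //; [exact: integrable_abse fi|exact: primitive_sub gG _ _|].
by move=> s /=; rewrite in_itv/= => /andP[as_ sb]; apply: fg; lra.
Qed.

Lemma primitiveD T f F g G : primitive_on T f F -> primitive_on T g G ->
  primitive_on T (fun s => f s + g s) (fun s => F s + G s).
Proof.
move=> fF gG; split.
  by apply: (integrableD _ (proj1 fF) (proj1 gG)).
move=> t t0 tT; rewrite (proj2 fF)// (proj2 gG)// RintegralD//.
- exact: primitive_sub fF _ _.
- exact: primitive_sub gG _ _.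
Qed.

Lemma primitiveZ T f F c : primitive_on T f F ->
  primitive_on T (fun s => c * f s) (fun s => c * F s).
Proof.
move=> fF; split.
  by apply: (integrableZl _ c (proj1 fF)).
move=> t t0 tT; rewrite (proj2 fF)// RintegralZl//.
exact: primitive_sub fF _ _.
Qed.

Lemma primitive_cst T c : 0 <= T -> primitive_on T (fun=> c) (fun t => c * t).
Proof.
move=> T0; split.
  apply/measurable_bounded_integrable => //.
    exact: compact_finite_measure (@segment_compact R 0 T).
  exact: bounded_cst.
move=> t t0 tT; rewrite Rintegral_cst//; congr (c * _).
rewrite [X in fine X](_ : _ = t%:E)//.
rewrite -[LHS]/(lebesgue_measure `[0, t]) lebesgue_measure_itv/= lte_fin.
by case: ltP => [_|]; [rewrite -EFinD/= subr0|move=> ?; have -> : t = 0 by [lra]].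
Qed.

Lemma eq_primitive T f F g G : f =1 g -> F =1 G ->
  primitive_on T f F -> primitive_on T g G.
Proof. by move=> /funext -> /funext ->. Qed.

Lemma primitive_sum (I : Type) (r : seq I) (P : pred I) T (f F : I -> R -> R) :
  0 <= T -> (forall i, P i -> primitive_on T (f i) (F i)) ->
  primitive_on T (fun s => \sum_(i <- r | P i) f i s)
                 (fun s => \sum_(i <- r | P i) F i s).
Proof.
move=> T0 fF; elim: r => [|i r IH].
  by apply: eq_primitive (primitive_cst T 0 T0) => s; rewrite big_nil ?mul0r.
case: (boolP (P i)) => [Pi|/negPf Pi].
  by apply: eq_primitive (primitiveD _ _ _ _ _ (fF i Pi) IH) => s; rewrite big_cons Pi.
by apply: eq_primitive IH => s; rewrite big_cons Pi.
Qed.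

Lemma primitive_norm T f F : primitive_on T f F ->
  primitive_on T (fun s => `|f s|) (fun t => \int[mu]_(s in `[0, t]) `|f s|).
Proof. by move=> [fi _]; split => //; exact: integrable_abse fi. Qed.

Lemma primitive_continuous T f F : 0 <= T -> primitive_on T f F ->
  {within `[0, T], continuous F}.
Proof.
move=> T0 [fi FE]; have ct := parameterized_integral_continuous T0 fi.
suff E : {in `[0, T]%classic, (fun x => parameterized_integral mu 0 x f) =1 F}.
  exact: (subspace_eq_continuous E ct).
by move=> t; rewrite inE/= in_itv/= => /andP[t0 tT]; rewrite FE.
Qed.

(** A continuous factor is bounded on the compact interval, so multiplying by it preserves
    integrability. *)
Lemma primitive_mul_integrable T f F G : 0 <= T ->
  primitive_on T f F -> {within `[0, T], continuous G} ->
  mu.-integrable `[0, T] (EFin \o (fun s => f s * G s)).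
Proof.
move=> T0 [fi _] cG.
have mG : measurable_fun `[0, T] G by exact: subspace_continuous_measurable_fun.
apply: (integrableMl _ fi mG) => //.
have /compact_bounded[M [_ GM]] := continuous_compact cG (@segment_compact R 0 T).
by exists M; split; rewrite ?num_real // => ? ? ? ?; exact: GM.
Qed.

(* Bisecting [[a, b]] at a point where [K] takes its mean value halves the constant [c]. *)
Lemma quadratic_increments T k K (D : R -> R) (c : R) : 0 <= T ->
  primitive_on T k K ->
  (forall s, 0 <= s -> s <= T -> 0 <= k s) ->
  (forall a b, 0 <= a -> a <= b -> b <= T -> D b - D a <= c * (K b - K a) ^+ 2) ->
  D T <= D 0.
Proof.
move=> T0 kK k0 DK.
have halves j : forall a b, 0 <= a -> a <= b -> b <= T ->
    D b - D a <= c / 2 ^+ j * (K b - K a) ^+ 2.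
  elim: j => [|j IH] a b a0 ab bT; first by rewrite expr0 divr1; exact: DK.
  have Kab : K a <= K b.
    by apply: (primitive_mono kK) => // s as_ sb; apply: k0; lra.
  have cK : {within `[a, b], continuous K}.
    apply: (continuous_subspaceW _ (primitive_continuous T k K T0 kK)).
    by apply: subset_itv; rewrite bnd_simp.
  have [|d + Kd] := @IVT R K a b ((K a + K b) / 2) ab cK.
    by rewrite min_l// max_r//; apply/andP; split; lra.
  rewrite in_itv/= => /andP[ad db].
  have h1 := IH a d a0 ad (le_trans db bT).
  have h2 := IH d b (le_trans a0 ad) db bT.
  rewrite (_ : c / _ * _ =
    c / 2 ^+ j * (K d - K a) ^+ 2 + c / 2 ^+ j * (K b - K d) ^+ 2); first lra.
  rewrite Kd exprS; field.
  by rewrite expf_neq0.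
(* The bound over the whole of [[0, T]] now holds with [c / 2 ^+ j] for every [j], hence falls below
   any [e > 0]; the Archimedean property and [j < 2 ^ j] supply a suitable [j]. *)
rewrite -subr_le0; apply/ler_addgt0Pl => e e0; rewrite addr0.
pose M := `|c * (K T - K 0) ^+ 2|.
have [j Mj] : exists j, M / e <= 2 ^+ j.
  exists (Num.bound (M / e)).
  have Me : 0 <= M / e by apply: divr_ge0; [exact: normr_ge0|exact: ltW].
  apply: (le_trans (ltW (archi_boundP Me))).
  by rewrite -natrX ler_nat ltnW// ltn_expl.
apply: (le_trans (halves j 0 T _ _ _)) => //.
rewrite mulrAC ler_pdivrMr ?exprn_gt0//; apply: (le_trans (ler_norm _)).
by rewrite -/M mulrC -ler_pdivrMr.
Qed.

Lemma primitive_density T f : mu.-integrable `[0, T] (EFin \o f) ->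
  primitive_on T f (fun t => \int[mu]_(s in `[0, t]) f s).
Proof. by []. Qed.

Lemma primitive_shrink T T' f F : T' <= T -> primitive_on T f F -> primitive_on T' f F.
Proof.
move=> T'T fF; split; first exact: (primitive_sub fF).
by move=> t t0 tT'; apply: (proj2 fF) => //; exact: le_trans T'T.
Qed.

(** Product rule. Let [P] be the integral of [f G + F g] and [K] that of [|f| + |g|]. Each increment
    of [F G - P] is at most the squared increment of [K] in absolute value, so
    [quadratic_increments], applied to both signs, shows that [F G - P] stays at its initial value
    0. *)
Lemma primitiveM T f F g G : 0 <= T -> primitive_on T f F -> primitive_on T g G ->
  primitive_on T (fun s => f s * G s + F s * g s) (fun s => F s * G s).
Proof.
move=> T0 fF gG.
have iP : mu.-integrable `[0, T] (EFin \o (fun s => f s * G s + F s * g s)).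
  apply: (@integrableD _ _ _ mu _ _ (EFin \o (fun s => f s * G s))
    (EFin \o (fun s => F s * g s))) => //.
    by apply: (primitive_mul_integrable T f F) => //; exact: primitive_continuous gG.
  rewrite (_ : (fun s => F s * g s) = (fun s => g s * F s)).
    by apply: (primitive_mul_integrable T g G) => //; exact: primitive_continuous fF.
  by apply/funext => s; rewrite mulrC.
split=> // t t0 tT.
have {iP} pP := primitive_density _ _ iP.
pose K := fun t => \int[mu]_(s in `[0, t]) `|f s| + \int[mu]_(s in `[0, t]) `|g s|.
have kK : primitive_on T (fun s => `|f s| + `|g s|) K.
  by apply: primitiveD; apply: primitive_norm; eassumption.
pose P t := \int[mu]_(s in `[0, t]) (f s * G s + F s * g s).
rewrite -/(P t).
have bound a b : 0 <= a -> a <= b -> b <= t ->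
    `|(F b * G b - P b) - (F a * G a - P a)| <= 1 * (K b - K a) ^+ 2.
  move=> a0 ab bt; have bT : b <= T by lra.
  (* The increment of [F G] is [G b (F b - F a) + F a (G b - G a)], which has the density
     [G b f + F a g] with frozen coefficients. Subtracting the true density leaves
     [(G b - G s) f s - (F s - F a) g s], where both coefficients are at most [K b - K a]. *)
  pose q s := (G b * f s + F a * g s) + (-1) * (f s * G s + F s * g s).
  pose Q s := (G b * F s + F a * G s) + (-1) * P s.
  have qQ : primitive_on T q Q by do 2?[apply: primitiveD]; apply: primitiveZ.
  rewrite (_ : _ - _ = Q b - Q a); last by rewrite /Q; ring.
  rewrite mul1r expr2 mulrBr.
  have kkK := primitiveZ _ _ _ (K b - K a) kK.
  apply: (primitive_norm_le qQ kkK) => // s as_ sb.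
  have h F' f' : primitive_on T f' F' -> (forall s, `|f' s| <= `|f s| + `|g s|) ->
      `|F' s - F' a| <= K b - K a /\ `|F' b - F' s| <= K b - K a.
    move=> fF' f'k; have ? : 0 <= s by lra.
    have Kas : K a <= K s by apply: (primitive_mono kK) => //; lra.
    have Ksb : K s <= K b by apply: (primitive_mono kK) => //; lra.
    split.
      apply: (@le_trans _ _ (K s - K a)); last by lra.
      by apply: (primitive_norm_le fF' kK) => //; lra.
    apply: (@le_trans _ _ (K b - K s)); last by lra.
    by apply: (primitive_norm_le fF' kK) => //; lra.
  have [h1 _] := h F f fF (fun s => ltac:(by rewrite lerDl)).
  have [_ h2] := h G g gG (fun s => ltac:(by rewrite lerDr)).
  rewrite (_ : q s = (G b - G s) * f s - (F s - F a) * g s); last by rewrite /q; ring.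
  rewrite (le_trans (ler_normB _ _))// !normrM mulrDr lerD//.
    exact: ler_wpM2r.
  exact: ler_wpM2r.
have kKt := primitive_shrink T t _ _ tT kK.
have F0 := primitive0 T0 fF; have P0 := primitive0 T0 pP.
apply/eqP; rewrite eq_le; apply/andP; split; rewrite -subr_le0.
  have := @quadratic_increments t _ K (fun s => F s * G s - P s) 1 t0 kKt.
  rewrite F0 /P P0 mul0r subrr; apply => // a b a0 ab bt.
  exact: le_trans (ler_norm _) (bound a b a0 ab bt).
have := @quadratic_increments t _ K (fun s => P s - F s * G s) 1 t0 kKt.
rewrite F0 /P P0 mul0r subrr; apply => // a b a0 ab bt.
apply: (le_trans _ (bound a b a0 ab bt)); apply: le_trans (ler_norm _) _.
rewrite -[leLHS]normrN le_eqVlt; apply/orP; left; apply/eqP; congr (`|_|).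
by rewrite /= -/(P a) -/(P b); ring.
Qed.

(* With [e^-H] decreasing, [e^-H V - G] has increments of second order:
   its formal derivative [e^-H (v - h V) - g] is nonpositive. *)
Lemma gronwall T v V g G h H : 0 <= T ->
  primitive_on T v V -> primitive_on T g G -> primitive_on T h H ->
  (forall s, 0 <= s -> s <= T -> 0 <= V s) ->
  (forall s, 0 <= s -> s <= T -> 0 <= g s) ->
  (forall s, 0 <= s -> s <= T -> 0 <= h s) ->
  (forall s, 0 <= s -> s <= T -> v s <= g s + h s * V s) ->
  V T <= expR (H T) * G T.
Proof.
move=> T0 vV gG hH V0 g0 h0 vgh.
pose K t := \int[mu]_(s in `[0, t]) `|v s| + H t.
have kK : primitive_on T (fun s => `|v s| + h s) K.
  by apply: primitiveD => //; apply: primitive_norm; eassumption.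
have k0 s : 0 <= s -> s <= T -> 0 <= `|v s| + h s.
  by move=> s0 sT; rewrite addr_ge0// h0.
have : expR (- H T) * V T - G T <= expR (- H 0) * V 0 - G 0.
  apply: (@quadratic_increments T _ K (fun t => expR (- H t) * V t - G t) 1 T0 kK) => //.
  move=> a b a0 ab bT.
  have Hab : H a <= H b by apply: (primitive_mono hH) => // s ? ?; apply: h0; lra.
  have Gab : G a <= G b by apply: (primitive_mono gG) => // s ? ?; apply: g0; lra.
  have Hb0 : 0 <= H b.
    rewrite -(primitive0 T0 hH).
    by apply: (primitive_mono hH) => //; [move=> s ? ?; apply: h0|]; lra.
  (* [V] is frozen at [a] in the term [h V]: the hypothesis gives [q s <= h s (V s - V a)], and
     [V s - V a] is at most [K b - K a]. Integration yields the squared increment of [K]. *)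
  pose q s := (v s + (-1) * g s) + (- V a) * h s.
  pose Q s := (V s + (-1) * G s) + (- V a) * H s.
  have qQ : primitive_on T q Q.
    by do 2?[apply: primitiveD => //]; apply: primitiveZ.
  have QK : Q b - Q a <= (K b - K a) * K b - (K b - K a) * K a.
    have kkK := primitiveZ _ _ _ (K b - K a) kK.
    apply: (primitive_le qQ kkK) => // s as_ sb.
    have s0 : 0 <= s by lra.
    have sT : s <= T by lra.
    have VK : V s - V a <= K b - K a.
      have Ksb : K s <= K b by apply: (primitive_mono kK) => // s' ? ?; apply: k0; lra.
      apply: (@le_trans _ _ (K s - K a)); last by lra.
      apply: (primitive_le vV kK) => // s' ? ?; apply: (le_trans (ler_norm _)).
      by rewrite lerDl h0//; lra.
    have hs := h0 s s0 sT; have vs := vgh s s0 sT.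
    have Kab : K a <= K b by apply: (primitive_mono kK) => // s' ? ?; apply: k0; lra.
    have := ler_wpM2r hs VK.
    have := mulr_ge0 (_ : 0 <= K b - K a) (normr_ge0 (v s)).
    by rewrite subr_ge0 => /(_ Kab); rewrite /q; nra.
  have e1 : expR (- H b) <= 1 by rewrite -expR0 ler_expR; lra.
  (* Tangent inequality [1 + x <= expR x] at [x = H b - H a]. Multiplied by [V a], it accounts for
     the term [V a (H b - H a)] in [E] below. *)
  have e2 : expR (- H b) - expR (- H a) <= - expR (- H b) * (H b - H a).
    have -> : - H a = - H b + (H b - H a) by ring.
    rewrite expRD; have := expR_ge1Dx (H b - H a).
    by have := expR_gt0 (- H b); nra.
  have Va : 0 <= V a by apply: V0; lra.
  have := ler_wpM2r Va e2.
  have Eb := expR_ge0 (- H b).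
  have E : (V b - V a - (G b - G a) - V a * (H b - H a)) <= (K b - K a) ^+ 2.
    by move: QK; rewrite /Q expr2; lra.
  have := ler_wpM2l Eb E.
  have K2 := sqr_ge0 (K b - K a).
  by nra.
rewrite (primitive0 T0 hH) (primitive0 T0 vV) (primitive0 T0 gG) mulr0 subr0 subr_le0.
move=> le1; rewrite -(ler_pM2l (expR_gt0 (- H T))) mulrA -expRD addNr expR0 mul1r.
exact: le1.
Qed.
End Primitives.

(** * Positive semidefinite matrices and Lyapunov operators *)

Section BilinearForms.
Import numFieldNormedType.Exports.
Local Open Scope classical_set_scope.
Variables (R : realType) (n : nat).
Implicit Types (X Y W : 'M[R]_n) (v w : 'cV[R]_n).

Definition bform X v w : R := (v^T *m X *m w) 0 0.

(** [psd] and [pd] constrain the quadratic form only; symmetry is carried separately as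
    [X^T = X]. *)
Definition psd X : Prop := forall v, 0 <= bform X v v.
Definition pd X : Prop := forall v, v != 0 -> 0 < bform X v v.

Lemma bformDl X v v' w : bform X (v + v') w = bform X v w + bform X v' w.
Proof. by rewrite /bform linearD/= !mulmxDl mxE. Qed.

Lemma bformDr X v w w' : bform X v (w + w') = bform X v w + bform X v w'.
Proof. by rewrite /bform !mulmxDr mxE. Qed.

Lemma bformZl X a v w : bform X (a *: v) w = a * bform X v w.
Proof. by rewrite /bform linearZ/= -!scalemxAl mxE. Qed.

Lemma bformZr X a v w : bform X v (a *: w) = a * bform X v w.
Proof. by rewrite /bform -!scalemxAr mxE. Qed.

Lemma bform0 X v : bform X v 0 = 0.
Proof. by rewrite /bform mulmx0 mxE. Qed.

Lemma bformC X v w : X^T = X -> bform X v w = bform X w v.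
Proof.
move=> Xs; rewrite /bform -[in LHS]trace_mx11 -mxtrace_tr trace_mx11.
by rewrite !trmx_mul trmxK Xs mulmxA.
Qed.

Lemma bform_addmx X Y v w : bform (X + Y) v w = bform X v w + bform Y v w.
Proof. by rewrite /bform mulmxDr mulmxDl mxE. Qed.

Lemma bform_scalemx a X v w : bform (a *: X) v w = a * bform X v w.
Proof. by rewrite /bform -scalemxAr -scalemxAl mxE. Qed.

Lemma bform_oppmx X v w : bform (- X) v w = - bform X v w.
Proof. by rewrite -scaleN1r bform_scalemx mulN1r. Qed.

Lemma bform_summx (I : Type) (r : seq I) (P : pred I) (X : I -> 'M[R]_n) v w :
  bform (\sum_(i <- r | P i) X i) v w = \sum_(i <- r | P i) bform (X i) v w.
Proof. by rewrite /bform mulmx_sumr mulmx_suml summxE. Qed.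

Lemma bform_delta X i j : bform X (delta_mx i 0) (delta_mx j 0) = X i j.
Proof. by rewrite /bform trmx_delta -rowE -colE !mxE. Qed.

Lemma psd_trmx_mul p (C : 'M[R]_(p, n)) : psd (C^T *m C).
Proof.
move=> v; rewrite /bform mulmxA -mulmxA -trmx_mul mxE.
by apply: sumr_ge0 => i _; rewrite mxE -expr2 sqr_ge0.
Qed.

Lemma psd_addmx X Y : psd X -> psd Y -> psd (X + Y).
Proof. by move=> hX hY v; rewrite bform_addmx addr_ge0. Qed.

Lemma psd_scalemx a X : 0 <= a -> psd X -> psd (a *: X).
Proof. by move=> a0 hX v; rewrite bform_scalemx mulr_ge0. Qed.

Lemma psd_diag_entry X i : psd X -> 0 <= X i i.
Proof. by move=> hX; rewrite -bform_delta. Qed.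

Lemma bform_quad X v w t : X^T = X ->
  bform X (w + t *: v) (w + t *: v)
    = bform X w w + 2 * t * bform X w v + t ^+ 2 * bform X v v.
Proof.
move=> Xs; rewrite !(bformDl, bformDr, bformZl, bformZr) (bformC _ v w Xs); ring.
Qed.

(** The quadratic polynomial [t |-> bform X (w + t v) (w + t v)] is nonnegative; its value at the
    minimiser [- b / c] gives the inequality. If [c = 0] it is affine, so its slope must vanish. *)
Lemma psd_CauchySchwarz X v w : X^T = X -> psd X ->
  bform X w v ^+ 2 <= bform X w w * bform X v v.
Proof.
move=> Xs hX; set a := bform X w w; set b := bform X w v; set c := bform X v v.
have q t : 0 <= a + 2 * t * b + t ^+ 2 * c by rewrite -bform_quad.
have c0 : 0 <= c by exact: hX.
have [c_gt0|] := ltrP 0 c; last first.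
  move=> cle0; have cE : c = 0 by lra.
  suff -> : b = 0 by rewrite expr0n mulr_ge0// hX.
  apply/eqP/negP => /negP b0.
  (* At this [t] the affine function [a + 2 t b] takes the value -1. *)
  have := q (- (a + 1) / (2 * b)); rewrite cE mulr0 addr0.
  have -> : 2 * (- (a + 1) / (2 * b)) * b = - (a + 1) by field.
  by lra.
have := q (- b / c).
have -> : a + 2 * (- b / c) * b + (- b / c) ^+ 2 * c = (a * c - b ^+ 2) / c.
  by field; rewrite gt_eqF.
by rewrite pmulr_lge0 ?invr_gt0// subr_ge0.
Qed.

(** Cauchy-Schwarz against the unit vectors makes every entry of [X *m v] vanish. *)
Lemma psd_kernel X v : X^T = X -> psd X -> bform X v v = 0 -> X *m v = 0.
Proof.
move=> Xs hX v0; apply/matrixP => i j; rewrite ord1 [RHS]mxE.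
have := psd_CauchySchwarz X v (delta_mx i 0) Xs hX.
rewrite v0 mulr0 /bform trmx_delta -mulmxA -rowE [X in X ^+ 2]mxE.
by move=> h; apply/eqP; rewrite -sqrf_eq0 eq_le h sqr_ge0.
Qed.

(** The form is tested at the sum and the difference of two unit vectors. The diagonal thus controls
    the whole matrix, which turns order relations between matrices into entrywise bounds. *)
Lemma psd_entry_le X i j : X^T = X -> psd X -> 2 * `|X i j| <= X i i + X j j.
Proof.
move=> Xs hX.
have q t : bform X (delta_mx i 0 + t *: delta_mx j 0) (delta_mx i 0 + t *: delta_mx j 0)
    = X i i + 2 * t * X i j + t ^+ 2 * X j j.
  by rewrite bform_quad// !bform_delta.
have h1 := hX (delta_mx i 0 + 1 *: delta_mx j 0).
have h2 := hX (delta_mx i 0 + (-1) *: delta_mx j 0).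
rewrite !q in h1 h2.
by case: (lerP 0 (X i j)) => ?; [rewrite ger0_norm//|rewrite ltr0_norm//]; nra.
Qed.

Lemma pd_psd X : pd X -> psd X.
Proof.
move=> hX v; have [->|v0] := eqVneq v 0; last exact/ltW/hX.
by rewrite bform0.
Qed.

Lemma pd_addmx X Y : psd X -> pd Y -> pd (X + Y).
Proof. by move=> hX hY v v0; rewrite bform_addmx ltr_wpDl// hY. Qed.

Lemma pd_scalemx a X : 0 < a -> pd X -> pd (a *: X).
Proof. by move=> a0 hX v v0; rewrite bform_scalemx mulr_gt0// hX. Qed.

Lemma pd_unitmx X : pd X -> X \in unitmx.
Proof.
move=> hX; rewrite -row_free_unit; apply: inj_row_free => v vX.
apply/eqP; case: eqVneq => // v0; have := hX v^T.
by rewrite trmx_eq0 => /(_ v0); rewrite /bform trmxK vX mul0mx mxE ltxx.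
Qed.

Lemma bform_continuous X : continuous (fun v : 'rV[R]_n => bform X v^T v^T).
Proof.
have -> : (fun v : 'rV[R]_n => bform X v^T v^T) =
    (fun v : 'rV[R]_n => \sum_j (\sum_i v 0 i * X i j) * v 0 j).
  apply/funext => v; rewrite /bform trmxK mxE.
  by apply: eq_bigr => j _; rewrite !mxE.
have cs (F : 'I_n -> 'rV[R]_n -> R) :
    (forall i, continuous (F i)) -> continuous (fun v : 'rV[R]_n => \sum_i F i v).
  by move=> cF; apply: continuous_big => //; exact: add_continuous.
apply: (cs _) => j x; apply: continuousM; last exact: coord_continuous.
by apply: (cs _) => i y; apply: continuousM; [exact: coord_continuous|exact: cst_continuous].
Qed.

(** The vector [c] minimises the Rayleigh quotient of [X] relative to [W] on the compact unit
    sphere; homogeneity of degree 0 extends minimality to all vectors. The vector [v0] makes the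
    sphere nonempty, and the quotients are cross-multiplied so that [v = 0] is covered. *)
Lemma min_rayleigh X W v0 : pd W -> v0 != 0 ->
  exists2 c, c != 0 & forall v, bform X c c * bform W v v <= bform X v v * bform W c c.
Proof.
move=> hW v0n.
pose S : set 'rV[R]_n := [set v | `|v| = 1].
have normalize (v : 'cV[R]_n) : v != 0 ->
    exists2 a : R, 0 < a & S (a *: v^T).
  rewrite -trmx_eq0 -normr_gt0 => nv; exists (`|v^T|)^-1; first by rewrite invr_gt0.
  by rewrite /S/= normrZ normfV normr_id mulVf// gt_eqF.
have Spos (v : 'rV[R]_n) : S v -> 0 < bform W v^T v^T.
  move=> /= Sv; apply: hW; rewrite trmx_eq0.
  by apply/eqP => v_0; move/eqP: v_0; rewrite -normr_eq0 Sv oner_eq0.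
have cS : compact S.
  apply: bounded_closed_compact.
    by exists 1; split => // x x1 v /= ->; exact: ltW.
  apply: (@preimage_closed _ _ (Num.norm : 'rV[R]_n -> R) [set 1]).
    by move=> x _; exact: norm_continuous.
  exact: closed_eq.
have S0 : S !=set0 by have [a _ Sa] := normalize v0 v0n; exists (a *: v0^T).
have cf : {within S, continuous (fun v : 'rV[R]_n => bform X v^T v^T / bform W v^T v^T)}.
  apply: continuous_in_subspaceT => v /set_mem Sv.
  have Wv : bform W v^T v^T != 0 by rewrite gt_eqF// Spos.
  have cW : {for v, continuous (fun v : 'rV[R]_n => (bform W v^T v^T)^-1)}.
    by apply: continuousV => //; exact: bform_continuous.
  have cX : {for v, continuous (fun v : 'rV[R]_n => bform X v^T v^T)}.
    exact: bform_continuous.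
  by refine (continuousM cX cW).
have [c /set_mem Sc cmin] := EVT_min_rV S0 cS cf.
exists c^T; first by apply/eqP => c0; have := Spos c Sc; rewrite c0 bform0 ltxx.
move=> v; have [->|vn] := eqVneq v 0; first by rewrite !bform0 mulr0 mul0r.
have [a a0 Sa] := normalize v vn.
have := cmin _ (mem_set Sa).
rewrite ler_pdivrMr ?Spos// mulrAC ler_pdivlMr ?Spos// linearZ/= trmxK.
rewrite !(bformZl, bformZr) => h.
have a2 : 0 < a * a by exact: mulr_gt0.
rewrite -(ler_pM2l a2); move: h; rewrite !mulrA => h.
by rewrite [leLHS](_ : _ = bform X c^T c^T * a * a * bform W v v)//; ring.
Qed.

End BilinearForms.
Arguments bform {R n}.
Arguments psd {R n}.
Arguments pd {R n}.

(** * Generalized Lyapunov operators: duality, positivity and solvability *)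

Section Lyapunov.
Variables (R : realType) (n m : nat).
Implicit Types (A X Y W : 'M[R]_n) (N : 'I_m -> 'M[R]_n).

Definition lyap A N X : 'M[R]_n :=
  A *m X + X *m A^T + \sum_(k < m) N k *m X *m (N k)^T.

Lemma lyapD A N X Y : lyap A N (X + Y) = lyap A N X + lyap A N Y.
Proof.
rewrite /lyap mulmxDr mulmxDl.
under eq_bigr do rewrite mulmxDr mulmxDl.
by rewrite big_split/= (addrACA (A *m X)) [LHS]addrACA.
Qed.

Lemma lyapZ A N a X : lyap A N (a *: X) = a *: lyap A N X.
Proof.
rewrite /lyap !scalerDr scaler_sumr -scalemxAr -scalemxAl; congr (_ + _).
by apply: eq_bigr => k _; rewrite -scalemxAr -scalemxAl.
Qed.

Lemma trmx_lyap A N X : (lyap A N X)^T = lyap A N X^T.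
Proof.
rewrite /lyap !linearD/= !trmx_mul trmxK [X in X + _]addrC linear_sum/=.
by congr (_ + _); apply: eq_bigr => k _; rewrite !trmx_mul trmxK mulmxA.
Qed.

(** The shift acts once from each side of [X], so half of [e] in the coefficient subtracts [e] from
    the operator. *)
Lemma lyap_shift A N X e : lyap (A - (e / 2)%:M) N X = lyap A N X - e *: X.
Proof.
rewrite /lyap linearB/= tr_scalar_mx mulmxBl mulmxBr mul_scalar_mx mul_mx_scalar.
by rewrite addrACA -opprD -scalerDl -splitr [LHS]addrAC.
Qed.

(** By cyclicity of the trace, transposing the coefficients gives the adjoint operator for the
    pairing [\tr (Y *m X)]. *)
Lemma mxtrace_lyap_adj A N X Y :
  \tr (lyap A^T (fun k => (N k)^T) Y *m X) = \tr (Y *m lyap A N X).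
Proof.
rewrite /lyap !mulmxDl !mulmxDr !linearD/= trmxK mulmx_suml mulmx_sumr !linear_sum/=.
congr (_ + _).
  rewrite addrC; congr (_ + _); first by rewrite mulmxA.
  by rewrite -mulmxA mxtrace_mulC mulmxA.
apply: eq_bigr => k _.
by rewrite trmxK -!mulmxA mxtrace_mulC !mulmxA.
Qed.

(* If [X] is not positive semidefinite, [M = a X - b W] is semidefinite with a kernel
   vector [c], so that [c^T L(M) c >= 0], against the signs of [L(X)] and [L(W)]. *)
Lemma lyap_psd A N W X : W^T = W -> pd W -> pd (- lyap A N W) ->
  X^T = X -> psd (- lyap A N X) -> psd X.
Proof.
move=> Ws hW LW Xs LX v0; rewrite leNgt; apply/negP => Xv0.
have v0n : v0 != 0 by apply/eqP => v00; move: Xv0; rewrite v00 bform0 ltxx.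
have [c c0 cmin] := min_rayleigh R n X W v0 hW v0n.
set a := bform W c c in cmin; set b := bform X c c in cmin.
have a0 : 0 < a by exact: hW.
have b0 : b < 0.
  have := cmin v0; have := hW v0 v0n; nra.
pose M := a *: X + (- b) *: W.
have Ms : M^T = M by rewrite /M linearD/= !linearZ/= Xs Ws.
have Mpsd : psd M.
  by move=> v; rewrite /M bform_addmx !bform_scalemx; have := cmin v; lra.
have Mc : M *m c = 0.
  by apply: psd_kernel => //; rewrite /M bform_addmx !bform_scalemx -/a -/b; lra.
have cM : c^T *m M = 0 by rewrite -[M]Ms -trmx_mul Mc trmx0.
(* Since [M c = 0] and [c^T M = 0], the terms in [A] vanish at [c]; each remaining term is the form
   of [M] at [N_k^T c]. *)
have : 0 <= bform (lyap A N M) c c.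
  rewrite /lyap !bform_addmx bform_summx {1 2}/bform.
  rewrite -mulmxA -[_ *m M *m c]mulmxA Mc !mulmx0 mulmxA cM !mul0mx mxE !add0r.
  apply: sumr_ge0 => k _; have := Mpsd ((N k)^T *m c).
  by rewrite /bform trmx_mul trmxK !mulmxA.
rewrite /M lyapD !lyapZ bform_addmx !bform_scalemx.
have := LX c; have := LW c c0; rewrite !bform_oppmx; nra.
Qed.

(** If [L(X) = 0] with [X] symmetric, then [lyap_psd] applies to both [X] and [- X], which forces
    [X = 0]. In finite dimension injectivity gives surjectivity. *)
Lemma lyap_solve A N W F : W^T = W -> pd W -> pd (- lyap A N W) -> F^T = F ->
  exists2 X, X^T = X & lyap A N X = F.
Proof.
move=> Ws hW LW Fs.
(* [f] acts as [L] on symmetric and as the identity on skew matrices (up to a factor 2),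
   so that its injectivity only involves [L] on symmetric matrices. *)
pose f (X : 'M[R]_n) := lyap A N (X + X^T) + (X - X^T).
have fZ a X : f (a *: X) = a *: f X.
  by rewrite /f linearZ/= -scalerDr -scalerBr lyapZ -scalerDr.
have fD X Y : f (X + Y) = f X + f Y.
  by rewrite /f [(X + Y)^T]linearD/= (addrACA X Y X^T) [lyap _ _ (_ + _ + _)]lyapD opprD (addrACA X Y) (addrACA (lyap _ _ _)).
have flin : linear f by move=> a X Y; rewrite fD fZ.
pose f_mixin := GRing.isLinear.Build R _ _ _ f flin.
pose fL : {linear 'M[R]_n -> 'M[R]_n} := HB.pack f f_mixin.
have split_sym X G : G^T = G -> f X = G -> X - X^T = 0 /\ lyap A N (X + X^T) = G.
  move=> Gs fX; have : f X = (f X)^T by rewrite fX.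
  (* Transposition fixes the Lyapunov term and negates the skew term, so a symmetric value of [f]
     forces [X] to be symmetric. *)
  rewrite /f linearD/= trmx_lyap !linearD/= linearN/= trmxK [X^T + X]addrC.
  move=> /addrI h; have h0 : X - X^T = 0.
    apply/matrixP => i j; move/matrixP/(_ i j): h; rewrite !mxE; lra.
  by split=> //; rewrite -fX /f h0 addr0.
have inj : lker (linfun fL) == 0%VS.
  rewrite -subv0; apply/subvP => X; rewrite memv_ker memv0 lfunE/= => /eqP fX0.
  have [sk L0] := split_sym X 0 (trmx0 _ _ _) fX0.
  have Xs : (X + X^T)^T = X + X^T by rewrite linearD/= trmxK addrC.
  have p1 : psd (X + X^T).
    by apply: (lyap_psd A N W) => //; rewrite L0 oppr0 => v; rewrite /bform mulmx0 mul0mx mxE.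
  have p2 : psd (- (X + X^T)).
    apply: (lyap_psd A N W) => //; first by rewrite linearN/= Xs.
    by rewrite -[- (X + X^T)]scaleN1r lyapZ L0 scaler0 oppr0 => v; rewrite /bform mulmx0 mul0mx mxE.
  have X2 : X + X^T = 0.
    apply/matrixP => i j; rewrite [RHS]mxE; apply/eqP; rewrite -normr_eq0.
    have := psd_entry_le _ _ _ i j Xs p1.
    have := psd_diag_entry _ _ _ i p2; have := psd_diag_entry _ _ _ j p2.
    move=> h1 h2 h3; rewrite [leRHS]mxE in h1; rewrite [leRHS]mxE in h2.
    rewrite eq_le normr_ge0 andbT; lra.
  apply/eqP/matrixP => i j; move/matrixP/(_ i j): X2; move/matrixP/(_ i j): sk.
  by rewrite !mxE; lra.
pose X := (linfun fL)^-1%VF F.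
have fX : f X = F by have := lker0_lfunVK inj F; rewrite lfunE.
have [_ LX] := split_sym X F Fs fX.
by exists (X + X^T) => //; rewrite linearD/= trmxK addrC.
Qed.

End Lyapunov.
Arguments lyap {R n m}.

(** * Output bound for a bilinear system *)

Section OutputBound.
Local Open Scope classical_set_scope.
Variables (R : realType) (n m : nat).
Notation mu := (@lebesgue_measure R).

Lemma itv0E (t : R) : itv0 t = `[0, t]%classic.
Proof. by apply/seteqP; split => s /=; rewrite in_itv. Qed.

Lemma measurable_halfline : measurable (@halfline R).
Proof.
rewrite (_ : @halfline R = `[0, +oo[%classic)//.
by apply/seteqP; split => s /=; rewrite in_itv/= andbT.
Qed.

(** Pointwise form of the energy estimate. The hypothesis is [L(X) + B B^T <= e X], and its slack
    [e X] adds [e] to the growth rate of [V]. *)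
Lemma energy_rate (A X : 'M[R]_n) (B : 'M[R]_(n, m)) (N : 'I_m -> 'M[R]_n)
    (e : R) (x : 'cV[R]_n) (u : 'cV[R]_m) :
  X^T = X -> pd X -> psd (e *: X - lyap A N X - B *m B^T) ->
  2 * bform (invmx X) x (A *m x + B *m u + \sum_(k < m) u k 0 *: (N k *m x))
    <= \sum_(k < m) u k 0 ^+ 2
       + (\sum_(k < m | N k != 0) u k 0 ^+ 2 + e) * bform (invmx X) x x.
Proof.
move=> Xs hX hL; have Xu := pd_unitmx _ _ _ hX; have Xpsd := pd_psd _ _ _ hX.
set M := invmx X; have Ms : M^T = M by rewrite /M trmx_inv Xs.
have [z xE xM] : exists2 z, x = X *m z & x^T *m M = z^T.
  by exists (M *m x); [rewrite mulKVmx|rewrite trmx_mul Ms].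
have VE : bform M x x = bform X z z.
  by rewrite /bform xM -mulmxA -xE.
have addE (a b : 'M[R]_1) : (a + b) 0 0 = a 0 0 + b 0 0 by rewrite mxE.
rewrite VE {1}/bform xM !mulmxDr !addE mulmx_sumr summxE.
have AE : bform (lyap A N X) z z = 2 * (z^T *m (A *m x)) 0 0
    + \sum_(k < m) bform X ((N k)^T *m z) ((N k)^T *m z).
  rewrite /lyap !bform_addmx bform_summx; congr (_ + _).
    rewrite mulrDl mul1r; congr (_ + _); first by rewrite /bform [in RHS]xE !mulmxA.
    by rewrite /bform -[LHS]trace_mx11 -mxtrace_tr trace_mx11 !trmx_mul !trmxK Xs [in RHS]xE !mulmxA.
  by apply: eq_bigr => k _; rewrite /bform trmx_mul trmxK !mulmxA.
have BE : bform (B *m B^T) z z = \sum_j (B^T *m z) j 0 ^+ 2.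
  rewrite /bform mulmxA -mulmxA -[z^T *m B]trmxK trmx_mul trmxK mxE.
  by apply: eq_bigr => j _; rewrite mxE expr2.
(* The difference of the two sides is the squared norm of [B^T z - u]. *)
have Bu : 2 * (z^T *m (B *m u)) 0 0 <= \sum_j (B^T *m z) j 0 ^+ 2 + \sum_j u j 0 ^+ 2.
  rewrite mulmxA -[z^T *m B]trmxK trmx_mul trmxK mxE mulr_sumr -big_split/=.
  apply: ler_sum => j _; rewrite mxE -subr_ge0.
  by rewrite (_ : _ - _ = ((B^T *m z) j 0 - u j 0) ^+ 2) ?sqr_ge0//; ring.
have Nu : 2 * \sum_(k < m) (z^T *m (u k 0 *: (N k *m x))) 0 0
    <= \sum_(k < m) bform X ((N k)^T *m z) ((N k)^T *m z)
       + (\sum_(k < m | N k != 0) u k 0 ^+ 2) * bform X z z.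
  rewrite mulr_sumr mulr_suml [X in _ + X]big_mkcond -big_split/=.
  (* A vanishing [N_k] contributes nothing, so only the components of [u^0] enter. Otherwise the
     form of [X] is nonnegative at [N_k^T z - u_k z]. *)
  apply: ler_sum => k _; case: eqVneq => [->|_] /=.
    by rewrite mul0mx scaler0 mulmx0 mxE mulr0 addr0 trmx0 mul0mx bform0.
  have := Xpsd ((N k)^T *m z + (- u k 0) *: z).
  rewrite bform_quad// -scalemxAr mxE.
  rewrite (_ : (z^T *m (N k *m x)) 0 0 = bform X ((N k)^T *m z) z); first by lra.
  by rewrite /bform trmx_mul trmxK [in LHS]xE !mulmxA.
have := hL z; rewrite !bform_addmx !bform_oppmx bform_scalemx AE BE.
lra.
Qed.

Lemma sqr_primitive (u : R -> 'cV[R]_m) k T : in_L2 u ->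
  primitive_on R T (fun s => u s k 0 ^+ 2)
    (fun t => \int[mu]_(s in `[0, t]) (u s k 0 ^+ 2)).
Proof.
move=> /(_ k)[mk ik].
have hm := measurable_halfline.
apply: primitive_density; apply: (@integrableS _ _ _ mu (@halfline R)) => //.
  by move=> s /=; rewrite in_itv => /andP[].
apply/integrableP; split.
  by apply/measurable_EFinP; apply: measurable_funX.
by under eq_integral do rewrite /= ger0_norm ?sqr_ge0//.
Qed.

Lemma sqr_integral_le (u : R -> 'cV[R]_m) k t : in_L2 u ->
  \int[mu]_(s in `[0, t]) (u s k 0 ^+ 2)
    <= fine (\int[mu]_(s in @halfline R) ((u s k 0) ^+ 2)%:E)%E.
Proof.
move=> uL2; have [mk ik] := uL2 k.
have sub : `[0, t] `<=` @halfline R by move=> s /=; rewrite in_itv => /andP[].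
have hm := measurable_halfline.
have ge0 (D : set R) : (0 <= \int[mu]_(s in D) ((u s k 0) ^+ 2)%:E)%E.
  by apply: integral_ge0 => s _; rewrite lee_fin sqr_ge0.
have le : (\int[mu]_(s in `[0%R, t]) ((u s k 0) ^+ 2)%:E
    <= \int[mu]_(s in @halfline R) ((u s k 0) ^+ 2)%:E)%E.
  apply: ge0_subset_integral => //.
    by apply/measurable_EFinP; apply: measurable_funX.
  by move=> s _; rewrite lee_fin sqr_ge0.
apply: fine_le => //; rewrite ge0_fin_numE//.
exact: le_lt_trans ik.
Qed.

(** [energy_rate] and Gronwall's inequality bound [V = x^T X^-1 x]. Each output component is the
    [X]-inner product of a row of [C] with [X^-1 x], so Cauchy-Schwarz bounds its square; summing
    over the rows produces the trace. *)
Lemma output_energy_bound p (A X : 'M[R]_n) (B : 'M[R]_(n, m)) (C : 'M[R]_(p, n))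
    (N : 'I_m -> 'M[R]_n) (e : R) (u : R -> 'cV[R]_m) (x : R -> 'cV[R]_n) (T : R) :
  X^T = X -> pd X -> 0 <= e -> psd (e *: X - lyap A N X - B *m B^T) ->
  in_L2 u -> bilinear_sol A B N u x -> 0 <= T ->
  \sum_i (C *m x T) i 0 ^+ 2 <=
    \tr (C *m X *m C^T) * (expR (e * T + L2sq_sub (fun k => N k != 0) u) * L2sq_sub predT u).
Proof.
move=> Xs hX e0 hL uL2 xsol T0.
have Xu := pd_unitmx _ _ _ hX; have Xpsd := pd_psd _ _ _ hX.
set M := invmx X; have Ms : M^T = M by rewrite /M trmx_inv Xs.
have Mpsd : psd M.
  move=> y; have := Xpsd (M *m y).
  by rewrite /bform trmx_mul Ms -!mulmxA [X *m _]mulmxA mulmxV// mul1mx.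
pose f s := A *m x s + B *m u s + \sum_(k < m) (u s k 0) *: (N k *m x s).
have fx i : primitive_on R T (fun s => f s i 0) (fun s => x s i 0).
  split; first by have [] := xsol T T0 i; rewrite itv0E.
  by move=> t t0 tT; have [_] := xsol t t0 i; rewrite itv0E.
pose V s := bform M (x s) (x s).
(* [V] is a quadratic polynomial in the coordinates, so its density follows from the product rule
   for each pair [x_i x_j]; symmetry of [M] merges the two halves into the factor 2. *)
have vV : primitive_on R T (fun s => 2 * bform M (x s) (f s)) V.
  have := primitive_sum R _ (index_enum 'I_n) predT T _ _ T0 (fun j _ =>
    primitive_sum R _ (index_enum 'I_n) predT T _ _ T0 (fun i _ =>
    primitiveZ R T _ _ (M i j) (primitiveM R T _ _ _ _ T0 (fx i) (fx j)))).
  have bE y w : bform M y w = \sum_j \sum_i M i j * (y i 0 * w j 0).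
    rewrite /bform mxE; apply: eq_bigr => j _.
    by rewrite mxE mulr_suml; apply: eq_bigr => i _; rewrite mxE; ring.
  apply: eq_primitive => s /=; last by rewrite /V bE.
  rewrite mulrDl mul1r {1}(bformC _ _ _ _ _ Ms) !bE -big_split/=.
  apply: eq_bigr => j _; rewrite -big_split/=.
  by apply: eq_bigr => i _; ring.
pose g s := \sum_(k < m) u s k 0 ^+ 2.
pose h s := \sum_(k < m | N k != 0) u s k 0 ^+ 2 + e.
pose G t := \sum_(k < m) \int[mu]_(s in `[0, t]) (u s k 0 ^+ 2).
pose H t := \sum_(k < m | N k != 0) \int[mu]_(s in `[0, t]) (u s k 0 ^+ 2) + e * t.
have gG : primitive_on R T g G.
  by apply: primitive_sum => // k _; exact: sqr_primitive.
have hH : primitive_on R T h H.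
  apply: primitiveD; last exact: primitive_cst.
  by apply: primitive_sum => // k _; exact: sqr_primitive.
have V0 s : 0 <= V s by exact: Mpsd.
have g0 s : 0 <= g s by apply: sumr_ge0 => k _; exact: sqr_ge0.
have h0 s : 0 <= h s by rewrite addr_ge0//; apply: sumr_ge0 => k _; exact: sqr_ge0.
have VT : V T <= expR (H T) * G T.
  apply: (gronwall R T _ _ _ _ _ _ T0 vV gG hH) => // s _ _.
  exact: energy_rate.
have GU : G T <= L2sq_sub predT u.
  by apply: ler_sum => k _; exact: sqr_integral_le.
have HU : H T <= e * T + L2sq_sub (fun k => N k != 0) u.
  by rewrite /H [leRHS]addrC lerD2r; apply: ler_sum => k _; exact: sqr_integral_le.
have VU : V T <= expR (e * T + L2sq_sub (fun k => N k != 0) u) * L2sq_sub predT u.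
  apply: (le_trans VT); apply: ler_pM => //; rewrite ?expR_ge0 ?ler_expR//.
  by apply: sumr_ge0 => k _; apply: Rintegral_ge0 => s _; exact: sqr_ge0.
pose c i : 'cV[R]_n := (row i C)^T.
have trE : \tr (C *m X *m C^T) = \sum_i bform X (c i) (c i).
  rewrite /mxtrace; apply: eq_bigr => i _.
  by rewrite /bform /c trmxK -row_mul [LHS]mxE [RHS]mxE; apply: eq_bigr => j _; rewrite [row _ _ _ _]mxE [(row _ _)^T _ _]mxE [row _ _ _ _]mxE [C^T _ _]mxE.
apply: (@le_trans _ _ (\tr (C *m X *m C^T) * V T)); last first.
  apply: ler_wpM2l => //; rewrite trE.
  by apply: sumr_ge0 => i _; exact: Xpsd.
rewrite trE mulr_suml; apply: ler_sum => i _.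
have -> : (C *m x T) i 0 = bform X (c i) (M *m x T).
  rewrite /bform /c trmxK -mulmxA mulKVmx//.
  by rewrite -row_mul [RHS]mxE.
have -> : V T = bform X (M *m x T) (M *m x T).
  by rewrite /V/bform trmx_mul Ms -!mulmxA mulKVmx.
exact: psd_CauchySchwarz.
Qed.

(** [W] makes the shifted operator strictly stable, [Z] does so for the dual one and dominates its
    solution, and [P] enters through traces alone. *)
Lemma output_bound p (A W Z P : 'M[R]_n) (B : 'M[R]_(n, m)) (C : 'M[R]_(p, n))
    (N : 'I_m -> 'M[R]_n) (u : R -> 'cV[R]_m) (x : R -> 'cV[R]_n) (T : R) :
  W^T = W -> pd W -> psd (- lyap A N W) ->
  Z^T = Z -> pd Z -> psd (- lyap A^T (fun k => (N k)^T) Z - C^T *m C) ->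
  lyap A N P = - (B *m B^T) ->
  in_L2 u -> bilinear_sol A B N u x -> 0 <= T ->
  \sum_i (C *m x T) i 0 ^+ 2 <=
    \tr (C *m P *m C^T) * (expR (L2sq_sub (fun k => N k != 0) u) * L2sq_sub predT u).
Proof.
move=> Ws hW LW Zs hZ LZ LP uL2 xsol T0.
set Nt := fun k => (N k)^T in LZ *.
(* A bound for [|\tr (Y *m P)|] that does not depend on [e], since [0 <= Y <= Z]. The number [w] is
   the cost of adding [e W] to [X]. *)
pose c := \sum_i \sum_j (Z i i + Z j j) * `|P j i|.
pose w := \tr (C *m W *m C^T).
set E := expR (L2sq_sub (fun k => N k != 0) u); set U := L2sq_sub predT u.
set Q := \sum_i _; set tau := \tr _.
have Q0 : 0 <= Q by apply: sumr_ge0 => i _; exact: sqr_ge0.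
have EU0 : 0 <= E * U.
  apply: mulr_ge0; first exact: expR_ge0.
  by apply: sumr_ge0 => k _; rewrite fine_ge0// integral_ge0// => s _; rewrite lee_fin sqr_ge0.
have trC (X : 'M[R]_n) : \tr (C *m X *m C^T) = \tr ((C^T *m C) *m X).
  by rewrite mxtrace_mulC mulmxA.
have psdCC : psd (C^T *m C) by exact: psd_trmx_mul.
have psdBB : psd (B *m B^T) by rewrite -[X in X *m _]trmxK; exact: psd_trmx_mul.
have LZ0 : psd (- lyap A^T Nt Z).
  by move=> v; have := LZ v; have := psdCC v; rewrite bform_addmx (bform_oppmx _ _ (C^T *m C)); lra.
suff main e : 0 < e -> Q <= (tau + e * c + e * w) * (expR (e * T) * (E * U)).
  rewrite -subr_le0; apply/ler_addgt0Pl => d d0; rewrite addr0.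
  (* Multiplying by [expR (- (e T))], which is at least [1 - e T], gives
     [Q <= tau E U + e (|c + w| E U + T Q)]. With [e = d / D] the error is at most [d]; the summand
     1 keeps [D] positive. *)
  pose D := `|c + w| * (E * U) + T * Q + 1.
  have D0 : 0 < D by rewrite ltr_wpDl// addr_ge0// mulr_ge0.
  have e0 : 0 < d / D by rewrite divr_gt0.
  set e := d / D in e0; have eD : e * D = d by rewrite /e divfK// gt_eqF.
  have := main e e0.
  have E1 : expR (e * T) * expR (- (e * T)) = 1 by rewrite -expRD subrr expR0.
  have := expR_ge1Dx (- (e * T)).
  have := expR_gt0 (- (e * T)); set a := expR (- _) in E1 *; set b := expR _ in E1 * => a0 a1 h.
  have h1 : Q * a <= (tau + e * c + e * w) * (E * U).
    have := ler_wpM2r (ltW a0) h.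
    rewrite [leRHS](_ : _ = (b * a) * ((tau + e * c + e * w) * (E * U))); last by ring.
    by rewrite E1 mul1r.
  have h2 : Q * (1 - e * T) <= Q * a by apply: ler_wpM2l.
  have h3 : (c + w) * (E * U) <= `|c + w| * (E * U) by rewrite ler_wpM2r// ler_norm.
  have := ler_wpM2l (ltW e0) h3.
  rewrite -eD /D; lra.
move=> e0.
have LeW : pd (- lyap (A - (e / 2)%:M) N W).
  by rewrite lyap_shift opprB addrC; apply: pd_addmx => //; exact: pd_scalemx.
have AtE : (A - (e / 2)%:M)^T = A^T - (e / 2)%:M by rewrite linearB/= tr_scalar_mx.
have LeZ : pd (- lyap (A - (e / 2)%:M)^T Nt Z).
  by rewrite AtE lyap_shift opprB addrC; apply: pd_addmx => //; exact: pd_scalemx.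
have [|X Xs LX] := lyap_solve _ _ _ _ N W (- (B *m B^T)) Ws hW LeW.
  by rewrite linearN/= trmx_mul trmxK.
have [|Y Ys LY] := lyap_solve _ _ _ _ Nt Z (- (C^T *m C)) Zs hZ LeZ.
  by rewrite linearN/= trmx_mul trmxK.
have Xpsd : psd X by apply: (lyap_psd _ _ _ _ N W) LeW Xs _ => //; rewrite LX opprK.
have Ypsd : psd Y by apply: (lyap_psd _ _ _ _ Nt Z) LeZ Ys _ => //; rewrite LY opprK.
(* The shifted dual operator sends [Z - Y] to at most [- e Z], so positivity of [Z - Y] follows from
   [lyap_psd]. *)
have ZYpsd : psd (Z - Y).
  apply: (lyap_psd _ _ _ _ Nt Z) LeZ _ _ => //; first by rewrite linearB/= Zs Ys.
  rewrite lyapD -[- Y]scaleN1r lyapZ LY scaleN1r opprK opprD AtE lyap_shift opprB -addrA.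
  by apply: psd_addmx => //; apply: psd_scalemx; [exact: ltW|exact: pd_psd].
(* Both traces are moved to [Y] by duality: [X] solves the shifted equation exactly, whereas [P]
   solves the unshifted one and leaves the residue [e P]. *)
have traces : \tr (C *m X *m C^T) = tau - e * \tr (Y *m P).
  rewrite /tau !trC -[C^T *m C]opprK -LY !mulNmx !linearN/= !mxtrace_lyap_adj.
  rewrite LX lyap_shift LP mulmxBr linearB/= -scalemxAr linearZ/=; ring.
have YP : `|\tr (Y *m P)| <= c.
  rewrite /mxtrace /c; apply: (le_trans (ler_norm_sum _ _ _)); apply: ler_sum => i _.
  rewrite mxE; apply: (le_trans (ler_norm_sum _ _ _)); apply: ler_sum => j _.
  rewrite normrM ler_wpM2r//.
  have h1 := psd_entry_le _ _ _ i j Ys Ypsd.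
  have h2 := psd_diag_entry _ _ _ i ZYpsd; have h3 := psd_diag_entry _ _ _ j ZYpsd.
  rewrite [leRHS]mxE [(- Y) _ _]mxE in h2; rewrite [leRHS]mxE [(- Y) _ _]mxE in h3.
  have := normr_ge0 (Y i j); lra.
(* [X] is only semidefinite; adding [e W] makes it definite. As [L(X) = e X - B B^T], the slack
   required is [e (e W - L(W))], which is semidefinite. *)
have := @output_energy_bound p A (X + e *: W) B C N e u x T _ _ (ltW e0) _ uL2 xsol T0.
have -> : \tr (C *m (X + e *: W) *m C^T) = tau - e * \tr (Y *m P) + e * w.
  by rewrite mulmxDr mulmxDl linearD/= traces -scalemxAr -scalemxAl mxtraceZ.
rewrite expRD -/E -/U -/Q.
move=> h; apply: (le_trans (h _ _ _)).
- by rewrite linearD/= linearZ/= Xs Ws.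
- by apply: pd_addmx => //; exact: pd_scalemx.
- have -> : e *: (X + e *: W) - lyap A N (X + e *: W) - B *m B^T
      = e *: (e *: W) + e *: (- lyap A N W).
    rewrite lyapD lyapZ; have := lyap_shift _ _ _ A N X e; rewrite LX => /eqP.
    rewrite eq_sym subr_eq => /eqP ->.
    by apply/matrixP => i j; rewrite !mxE; ring.
  apply: psd_addmx; last exact: psd_scalemx (ltW e0) _.
  by do 2?[apply: psd_scalemx; first exact: ltW]; exact: pd_psd.
rewrite -mulrA; apply: ler_wpM2r; first by rewrite mulr_ge0// expR_ge0.
rewrite lerD2r lerD2l -mulrN; apply: ler_wpM2l; first exact: ltW.
by apply: le_trans YP; rewrite -normrN ler_norm.
Qed.

End OutputBound.

(** * The error system *)

Lemma mxtraceN (R : pzRingType) n (X : 'M[R]_n) : \tr (- X) = - \tr X.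
Proof. by rewrite linearN. Qed.

Section BlockSums.
Variables (V : zmodType) (I : Type) (rI : seq I) (p1 p2 q1 q2 : nat).

Lemma sum_row_mx (F : I -> 'M[V]_(p1, q1)) (G : I -> 'M[V]_(p1, q2)) :
  \sum_(i <- rI) row_mx (F i) (G i) = row_mx (\sum_(i <- rI) F i) (\sum_(i <- rI) G i).
Proof.
elim: rI => [|i l IH]; first by rewrite !big_nil row_mx0.
by rewrite !big_cons IH add_row_mx.
Qed.

Lemma sum_col_mx (F : I -> 'M[V]_(p1, q1)) (G : I -> 'M[V]_(p2, q1)) :
  \sum_(i <- rI) col_mx (F i) (G i) = col_mx (\sum_(i <- rI) F i) (\sum_(i <- rI) G i).
Proof.
elim: rI => [|i l IH]; first by rewrite !big_nil col_mx0.
by rewrite !big_cons IH add_col_mx.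
Qed.

Lemma usubmxD (X Y : 'M[V]_(p1 + p2, q1)) : usubmx (X + Y) = usubmx X + usubmx Y.
Proof. by apply/matrixP => i j; rewrite !mxE. Qed.

Lemma dsubmxD (X Y : 'M[V]_(p1 + p2, q1)) : dsubmx (X + Y) = dsubmx X + dsubmx Y.
Proof. by apply/matrixP => i j; rewrite !mxE. Qed.

Lemma usubmxN (X : 'M[V]_(p1 + p2, q1)) : usubmx (- X) = - usubmx X.
Proof. by apply/matrixP => i j; rewrite !mxE. Qed.

Lemma dsubmxN (X : 'M[V]_(p1 + p2, q1)) : dsubmx (- X) = - dsubmx X.
Proof. by apply/matrixP => i j; rewrite !mxE. Qed.

Lemma usubmx_sum (F : I -> 'M[V]_(p1 + p2, q1)) :
  usubmx (\sum_(i <- rI) F i) = \sum_(i <- rI) usubmx (F i).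
Proof.
apply/matrixP => i j; rewrite mxE !summxE.
by apply: eq_bigr => k _; rewrite mxE.
Qed.

Lemma dsubmx_sum (F : I -> 'M[V]_(p1 + p2, q1)) :
  dsubmx (\sum_(i <- rI) F i) = \sum_(i <- rI) dsubmx (F i).
Proof.
apply/matrixP => i j; rewrite mxE !summxE.
by apply: eq_bigr => k _; rewrite mxE.
Qed.

Lemma ulsubmxD (X Y : 'M[V]_(p1 + p2, q1 + q2)) :
  ulsubmx (X + Y) = ulsubmx X + ulsubmx Y.
Proof. by apply/matrixP => i j; rewrite !mxE. Qed.

Lemma ulsubmxN (X : 'M[V]_(p1 + p2, q1 + q2)) : ulsubmx (- X) = - ulsubmx X.
Proof. by apply/matrixP => i j; rewrite !mxE. Qed.

Lemma ulsubmx_sum (F : I -> 'M[V]_(p1 + p2, q1 + q2)) :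
  ulsubmx (\sum_(i <- rI) F i) = \sum_(i <- rI) ulsubmx (F i).
Proof.
apply/matrixP => i j; rewrite !mxE !summxE.
by apply: eq_bigr => k _; rewrite !mxE.
Qed.

End BlockSums.

(** * Lyapunov operators on block matrices and the trace identity *)

Section BlockLyapunov.
Variables (R : realType) (m : nat).

Lemma lyap_block_diag a b (A : 'M[R]_a) (A' : 'M[R]_b) (N : 'I_m -> 'M[R]_a)
    (N' : 'I_m -> 'M[R]_b) X Y Y' X' :
  lyap (block_mx A 0 0 A') (fun k => block_mx (N k) 0 0 (N' k)) (block_mx X Y Y' X')
  = block_mx (lyap A N X) (A *m Y + Y *m A'^T + \sum_(k < m) N k *m Y *m (N' k)^T)
      (A' *m Y' + Y' *m A^T + \sum_(k < m) N' k *m Y' *m (N k)^T) (lyap A' N' X').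
Proof.
have Nk k : block_mx (N k) 0 0 (N' k) *m block_mx X Y Y' X' *m (block_mx (N k) 0 0 (N' k))^T
    = row_mx (col_mx (N k *m X *m (N k)^T) (N' k *m Y' *m (N k)^T))
             (col_mx (N k *m Y *m (N' k)^T) (N' k *m X' *m (N' k)^T)).
  rewrite -block_mxEh tr_block_mx !trmx0 !mulmx_block.
  by rewrite !(mul0mx, mulmx0, addr0, add0r).
rewrite /lyap (eq_bigr _ (fun k _ => Nk k)) sum_row_mx !sum_col_mx -block_mxEh.
rewrite tr_block_mx !trmx0 !mulmx_block !(mul0mx, mulmx0, addr0, add0r).
by rewrite !add_block_mx.
Qed.

Variables (r s : nat).
Implicit Types (A S : 'M[R]_(r + s)) (N : 'I_m -> 'M[R]_(r + s)).

Lemma bform_ulsubmx (X : 'M[R]_(r + s)) v w :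
  bform (ulsubmx X) v w = bform X (col_mx v 0) (col_mx w 0).
Proof.
rewrite /bform -[in RHS](submxK X) tr_col_mx mul_row_block mul_row_col.
by rewrite !trmx0 !(mul0mx, mulmx0, addr0).
Qed.

Lemma psd_ulsubmx (X : 'M[R]_(r + s)) : psd X -> psd (ulsubmx X).
Proof. by move=> hX v; rewrite bform_ulsubmx. Qed.

Lemma pd_ulsubmx (X : 'M[R]_(r + s)) : pd X -> pd (ulsubmx X).
Proof.
by move=> hX v v0; rewrite bform_ulsubmx hX// col_mx_eq0 negb_and v0.
Qed.

Lemma bform_block_diag a b (X : 'M[R]_a) (Y : 'M[R]_b) (v : 'cV[R]_(a + b)) :
  bform (block_mx X 0 0 Y) v v
    = bform X (usubmx v) (usubmx v) + bform Y (dsubmx v) (dsubmx v).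
Proof.
rewrite /bform -[in LHS](vsubmxK v) tr_col_mx mul_row_block mul_row_col.
by rewrite !(mul0mx, mulmx0, addr0, add0r) mxE.
Qed.

Lemma psd_block_diag a b (X : 'M[R]_a) (Y : 'M[R]_b) :
  psd X -> psd Y -> psd (block_mx X 0 0 Y).
Proof. by move=> hX hY v; rewrite bform_block_diag addr_ge0. Qed.

Lemma pd_block_diag a b (X : 'M[R]_a) (Y : 'M[R]_b) :
  pd X -> pd Y -> pd (block_mx X 0 0 Y).
Proof.
move=> hX hY v v0; rewrite bform_block_diag.
have [u0|u0] := eqVneq (usubmx v) 0; last first.
  by rewrite ltr_pwDl ?hX//; exact: (pd_psd _ _ _ hY).
have d0 : dsubmx v != 0.
  apply: contra_neq v0 => d0; by rewrite -[v]vsubmxK u0 d0 col_mx0.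
by rewrite ltr_wpDl ?hY//; exact: (pd_psd _ _ _ hX).
Qed.

(** For block-diagonal [S] the off-diagonal blocks of [A] do not reach the leading block; truncation
    loses only the semidefinite terms [N_{k,12} S_2 N_{k,12}^T]. *)
Lemma ulsubmx_lyap_diag A N S : ursubmx S = 0 -> dlsubmx S = 0 ->
  ulsubmx (lyap A N S) = lyap (ulsubmx A) (fun k => ulsubmx (N k)) (ulsubmx S)
    + \sum_(k < m) ursubmx (N k) *m drsubmx S *m (ursubmx (N k))^T.
Proof.
move=> Sur Sdl; have SE := submxK S; rewrite Sur Sdl in SE.
rewrite /lyap -[RHS]addrA -big_split/= !ulsubmxD ulsubmx_sum; congr (_ + _ + _).
- by rewrite -[in LHS](submxK A) -SE mulmx_block !block_mxKul !mulmx0 addr0.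
- rewrite -[in LHS](submxK A) tr_block_mx -SE mulmx_block !block_mxKul.
  by rewrite !mul0mx addr0.
- apply: eq_bigr => k _; rewrite -[in LHS](submxK (N k)) tr_block_mx -[in LHS]SE.
  by rewrite !mulmx_block !block_mxKul !(mulmx0, addr0, add0r).
Qed.

(* Both Gramian inequalities pass to the leading block, which is what makes the
   truncated system marginally stable. *)
Lemma psd_ulsubmx_lyap A N S D : ursubmx S = 0 -> dlsubmx S = 0 -> psd S ->
  psd (- lyap A N S - D) ->
  psd (- lyap (ulsubmx A) (fun k => ulsubmx (N k)) (ulsubmx S) - ulsubmx D).
Proof.
move=> Sur Sdl hS hL.
have -> : - lyap (ulsubmx A) (fun k => ulsubmx (N k)) (ulsubmx S) - ulsubmx D
    = ulsubmx (- lyap A N S - D)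
      + \sum_(k < m) ursubmx (N k) *m drsubmx S *m (ursubmx (N k))^T.
  rewrite ulsubmxD !ulsubmxN ulsubmx_lyap_diag//.
  by move: (lyap (ulsubmx A) _ _) => L; rewrite opprD [RHS]addrAC subrK.
apply: psd_addmx; first exact: psd_ulsubmx.
move=> v; rewrite bform_summx; apply: sumr_ge0 => k _.
have := hS (col_mx 0 ((ursubmx (N k))^T *m v)).
rewrite -(submxK S) Sur Sdl bform_block_diag col_mxKu col_mxKd bform0 add0r.
by rewrite /bform block_mxKdr trmx_mul trmxK !mulmxA.
Qed.

(** Padding [Q] with zero columns makes it square, so that duality for [lyap] applies; the left
    block is the operator in the equation for [P_g]. *)
Lemma lyap_row_mx A N (Q : 'M[R]_(r + s, r)) :
  lyap A N (row_mx Q 0) =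
  row_mx (A *m Q + Q *m (ulsubmx A)^T + \sum_(k < m) N k *m Q *m (ulsubmx (N k))^T)
         (Q *m (dlsubmx A)^T + \sum_(k < m) N k *m Q *m (dlsubmx (N k))^T).
Proof.
have trE (M : 'M[R]_(r + s)) : M^T =
    block_mx (ulsubmx M)^T (dlsubmx M)^T (ursubmx M)^T (drsubmx M)^T.
  by rewrite -tr_block_mx submxK.
have Nk k : N k *m row_mx Q 0 *m (N k)^T =
    row_mx (N k *m Q *m (ulsubmx (N k))^T) (N k *m Q *m (dlsubmx (N k))^T).
  by rewrite [(N k)^T]trE mul_mx_row mulmx0 mul_row_block !mul0mx !addr0.
rewrite /lyap (eq_bigr _ (fun k _ => Nk k)) sum_row_mx.
by rewrite [A^T]trE mul_mx_row mulmx0 mul_row_block !mul0mx !addr0 !add_row_mx add0r.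
Qed.

Lemma mxtrace_diag_row_mx S (U : 'M[R]_(r + s, r)) (V : 'M[R]_(r + s, s)) :
  ursubmx S = 0 -> dlsubmx S = 0 ->
  \tr (S *m row_mx U V)
    = \tr (ulsubmx S *m usubmx U) + \tr (drsubmx S *m dsubmx V).
Proof.
move=> Sur Sdl; rewrite -[in LHS](submxK S) Sur Sdl.
rewrite -[in LHS](vsubmxK U) -[in LHS](vsubmxK V) -block_mxEh mulmx_block.
by rewrite mxtrace_block !mul0mx addr0 add0r.
Qed.

(** Duality rewrites each trace as [- \tr (S *m lyap A N X)], with [X] equal to [S], to [Pg] padded
    by zeros and to [Phat] padded by zeros. The contributions paired with the leading block of [S]
    are multiples 1, -2 and 1 of the same number and cancel, so only the block [Sigma_2]
    survives. *)
Lemma error_trace p q A N S (B : 'M[R]_(r + s, q)) (C : 'M[R]_(p, r + s)) Phat Pg :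
  ursubmx S = 0 -> dlsubmx S = 0 ->
  lyap A N S = - (B *m B^T) ->
  lyap A^T (fun k => (N k)^T) S = - (C^T *m C) ->
  lyap (ulsubmx A) (fun k => ulsubmx (N k)) Phat = - (usubmx B *m (usubmx B)^T) ->
  A *m Pg + Pg *m (ulsubmx A)^T + \sum_(k < m) N k *m Pg *m (ulsubmx (N k))^T
    = - (B *m (usubmx B)^T) ->
  \tr (C *m S *m C^T) - 2 * \tr (C *m Pg *m (lsubmx C)^T)
    + \tr (lsubmx C *m Phat *m (lsubmx C)^T)
  = \tr (drsubmx S *m (
      dsubmx B *m (dsubmx B)^T + 2%:R *: (dsubmx Pg *m (dlsubmx A)^T)
      + \sum_(k < m) (2%:R *: (drsubmx (N k) *m dsubmx Pg *m (dlsubmx (N k))^T)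
                      + 2%:R *: (dlsubmx (N k) *m usubmx Pg *m (dlsubmx (N k))^T)
                      - dlsubmx (N k) *m Phat *m (dlsubmx (N k))^T))).
Proof.
move=> Sur Sdl LS LSt LP LPg.
have dual X : \tr (C *m X *m C^T) = - \tr (S *m lyap A N X).
  by rewrite mxtrace_mulC mulmxA -[C^T *m C]opprK -LSt mulNmx linearN/= mxtrace_lyap_adj.
have lift_row Q : \tr (C *m Q *m (lsubmx C)^T) = \tr (C *m row_mx Q 0 *m C^T).
  have -> : C^T = col_mx (lsubmx C)^T (rsubmx C)^T by rewrite -tr_row_mx hsubmxK.
  by rewrite mul_mx_row mulmx0 mul_row_col mul0mx addr0.
have Phat_lift : lsubmx C *m Phat = C *m col_mx Phat 0.
  by rewrite -[in RHS](hsubmxK C) mul_row_col mulmx0 addr0.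
have mul_lift (M : 'M[R]_(r + s)) :
    M *m col_mx Phat 0 = col_mx (ulsubmx M *m Phat) (dlsubmx M *m Phat).
  by rewrite -[in LHS](submxK M) mul_block_col !mulmx0 !addr0.
rewrite Phat_lift !lift_row !dual !lyap_row_mx LPg LS.
have -> : B *m B^T = row_mx (B *m (usubmx B)^T) (B *m (dsubmx B)^T).
  by rewrite -mul_mx_row -tr_col_mx vsubmxK.
rewrite opp_row_mx !mxtrace_diag_row_mx//.
(* The upper rows reproduce the reduced Gramian equation; the lower rows, treated next, keep only
   the quadratic terms in [N_{k,21}]. *)
have -> : usubmx (A *m col_mx Phat 0 + col_mx Phat 0 *m (ulsubmx A)^T
    + \sum_(k < m) N k *m col_mx Phat 0 *m (ulsubmx (N k))^T)
    = - (usubmx B *m (usubmx B)^T).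
  rewrite -LP /lyap !usubmxD usubmx_sum mul_lift mul_col_mx !col_mxKu.
  by congr (_ + _); apply: eq_bigr => k _; rewrite mul_lift mul_col_mx col_mxKu.
have -> : dsubmx (col_mx Phat 0 *m (dlsubmx A)^T
    + \sum_(k < m) N k *m col_mx Phat 0 *m (dlsubmx (N k))^T)
    = \sum_(k < m) dlsubmx (N k) *m Phat *m (dlsubmx (N k))^T.
  rewrite dsubmxD dsubmx_sum mul_col_mx col_mxKd mul0mx add0r.
  by apply: eq_bigr => k _; rewrite mul_lift mul_col_mx col_mxKd.
have -> : dsubmx (Pg *m (dlsubmx A)^T + \sum_(k < m) N k *m Pg *m (dlsubmx (N k))^T)
    = dsubmx Pg *m (dlsubmx A)^T
      + \sum_(k < m) (drsubmx (N k) *m dsubmx Pg *m (dlsubmx (N k))^T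
          + dlsubmx (N k) *m usubmx Pg *m (dlsubmx (N k))^T).
  rewrite dsubmxD dsubmx_sum -mul_dsub_mx; congr (_ + _).
  apply: eq_bigr => k _; rewrite -mul_dsub_mx -mulmxDl; congr (_ *m _).
  rewrite -mul_dsub_mx -[in LHS](submxK (N k)) -[in LHS](vsubmxK Pg).
  by rewrite block_mxEv col_mxKd mul_row_col addrC.
have -> : \sum_(k < m) (2%:R *: (drsubmx (N k) *m dsubmx Pg *m (dlsubmx (N k))^T)
      + 2%:R *: (dlsubmx (N k) *m usubmx Pg *m (dlsubmx (N k))^T)
      - dlsubmx (N k) *m Phat *m (dlsubmx (N k))^T)
    = 2%:R *: (\sum_(k < m) (drsubmx (N k) *m dsubmx Pg *m (dlsubmx (N k))^T
          + dlsubmx (N k) *m usubmx Pg *m (dlsubmx (N k))^T))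
      - \sum_(k < m) dlsubmx (N k) *m Phat *m (dlsubmx (N k))^T.
  by rewrite scaler_sumr -sumrB; apply: eq_bigr => k _; rewrite scalerDr.
move: (\sum_(k < m) _) (\sum_(k < m) _) => X Y.
rewrite addrA -[_ + _ + 2%:R *: Y]addrA -scalerDr.
rewrite !usubmxN !dsubmxN -!mul_usub_mx -!mul_dsub_mx !mulmxN mulmxBr mulmxDr.
rewrite !(mxtraceN, mxtraceD).
rewrite mulmxDr mxtraceD -scalemxAr mxtraceZ mulmxDr mxtraceD; ring.
Qed.

End BlockLyapunov.

(** * Diagonal Gramians, the joint trajectory and the error bound *)

Lemma pd_diag_mx (R : realType) n (d : 'rV[R]_n) :
  (forall i, 0 < d 0 i) -> pd (diag_mx d).
Proof.
move=> d0 v v0; rewrite /bform mul_mx_diag mxE.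
have term i : (\matrix_(i, j) (v^T i j * d 0 j)) 0 i * v i 0 = d 0 i * v i 0 ^+ 2.
  by rewrite !mxE expr2; ring.
under eq_bigr do rewrite term.
have ge0 i : true -> 0 <= d 0 i * v i 0 ^+ 2 by move=> _; rewrite mulr_ge0 ?sqr_ge0// ltW.
rewrite lt0r sumr_ge0// andbT psumr_eq0//; apply: contra v0 => /allP all0.
apply/eqP/matrixP => i j; rewrite ord1 mxE; apply/eqP.
have := all0 i (mem_index_enum i); rewrite mulf_eq0 gt_eqF ?d0//=.
by rewrite sqrf_eq0.
Qed.

Lemma ursubmx_diag_mx (R : pzRingType) r s (d : 'rV[R]_(r + s)) : ursubmx (diag_mx d) = 0.
Proof. by apply/matrixP => i j; rewrite !mxE eq_lrshift mulr0n. Qed.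

Lemma dlsubmx_diag_mx (R : pzRingType) r s (d : 'rV[R]_(r + s)) : dlsubmx (diag_mx d) = 0.
Proof. by apply/matrixP => i j; rewrite !mxE eq_rlshift mulr0n. Qed.

Lemma bilinear_sol_block (R : realType) (a b m : nat) (A : 'M[R]_a) (A' : 'M[R]_b)
    (B : 'M[R]_(a, m)) (B' : 'M[R]_(b, m)) (N : 'I_m -> 'M[R]_a) (N' : 'I_m -> 'M[R]_b)
    (u : R -> 'cV[R]_m) (x : R -> 'cV[R]_a) (x' : R -> 'cV[R]_b) :
  bilinear_sol A B N u x -> bilinear_sol A' B' N' u x' ->
  bilinear_sol (block_mx A 0 0 A') (col_mx B B') (fun k => block_mx (N k) 0 0 (N' k))
    u (fun t => col_mx (x t) (x' t)).
Proof.
move=> sx sx' t t0 l.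
have fE s : block_mx A 0 0 A' *m col_mx (x s) (x' s) + col_mx B B' *m u s
    + \sum_(k < m) u s k 0 *: (block_mx (N k) 0 0 (N' k) *m col_mx (x s) (x' s))
    = col_mx (A *m x s + B *m u s + \sum_(k < m) u s k 0 *: (N k *m x s))
             (A' *m x' s + B' *m u s + \sum_(k < m) u s k 0 *: (N' k *m x' s)).
  under eq_bigr do rewrite mul_block_col !mul0mx addr0 add0r scale_col_mx.
  by rewrite sum_col_mx mul_block_col !mul0mx addr0 add0r mul_col_mx !add_col_mx.
rewrite -[l]splitK; case: (fintype.split l) => j /=.
  have [fi fx] := sx t t0 j; rewrite col_mxEu fx.
  by under eq_fun do rewrite fE col_mxEu.
have [fi fx] := sx' t t0 j; rewrite col_mxEd fx.
by under eq_fun do rewrite fE col_mxEd.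
Qed.

Theorem theorem5p1 (R : realType) (r s m p : nat)
  (A : 'M[R]_(r + s)) (B : 'M[R]_(r + s, m)) (C : 'M[R]_(p, r + s))
  (N : 'I_m -> 'M[R]_(r + s)) (sig : 'rV[R]_(r + s))
  (Phat : 'M[R]_r) (Pg : 'M[R]_(r + s, r)) :
  spec_in_Cminus (lyap_kron A N) ->
  (forall i, 0 < sig 0 i) ->
  (* balanced: P = Q = Sigma = diag(sigma) *)
  A *m diag_mx sig + diag_mx sig *m A^T + \sum_(k < m) N k *m diag_mx sig *m (N k)^T
    = - (B *m B^T) ->
  A^T *m diag_mx sig + diag_mx sig *m A + \sum_(k < m) (N k)^T *m diag_mx sig *m N k
    = - (C^T *m C) ->
  ulsubmx A *m Phat + Phat *m (ulsubmx A)^T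
    + \sum_(k < m) ulsubmx (N k) *m Phat *m (ulsubmx (N k))^T
    = - (usubmx B *m (usubmx B)^T) ->
  A *m Pg + Pg *m (ulsubmx A)^T + \sum_(k < m) N k *m Pg *m (ulsubmx (N k))^T
    = - (B *m (usubmx B)^T) ->
  forall (u : R -> 'cV[R]_m) (x : R -> 'cV[R]_(r + s)) (xhat : R -> 'cV[R]_r),
    in_L2 u ->
    bilinear_sol A B N u x ->
    bilinear_sol (ulsubmx A) (usubmx B) (fun k => ulsubmx (N k)) u xhat ->
    let K : 'M[R]_s :=
      dsubmx B *m (dsubmx B)^T + 2%:R *: (dsubmx Pg *m (dlsubmx A)^T)
      + \sum_(k < m) (2%:R *: (drsubmx (N k) *m dsubmx Pg *m (dlsubmx (N k))^T)
                      + 2%:R *: (dlsubmx (N k) *m usubmx Pg *m (dlsubmx (N k))^T)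
                      - dlsubmx (N k) *m Phat *m (dlsubmx (N k))^T) in
    forall t : R, 0 <= t ->
      eucl (C *m x t - lsubmx C *m xhat t)
        <= Num.sqrt (\tr (drsubmx (diag_mx sig) *m K))
           * expR (2^-1 * L2sq_sub (fun k => N k != 0) u)
           * Num.sqrt (L2sq_sub predT u).
Proof.
move=> _ sig0 LS LSt LP LPg u x xhat uL2 xsol xhatsol K t t0.
have Spd := pd_diag_mx _ _ _ sig0.
have Ss := tr_diag_mx sig.
have Sur := ursubmx_diag_mx _ _ _ sig; have Sdl := dlsubmx_diag_mx _ _ _ sig.
set S := diag_mx sig in LS LSt Spd Ss Sur Sdl *.
have {}LS : lyap A N S = - (B *m B^T) by [].
have {}LSt : lyap A^T (fun k => (N k)^T) S = - (C^T *m C).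
  rewrite -LSt /lyap trmxK; congr (_ + _).
  by apply: eq_bigr => k _; rewrite trmxK.
pose A1 := ulsubmx A; pose N1 k := ulsubmx (N k); pose S1 := ulsubmx S.
pose B1 := usubmx B; pose C1 := lsubmx C.
pose Ae := block_mx A 0 0 A1; pose Ne k := block_mx (N k) 0 0 (N1 k).
pose Be := col_mx B B1; pose Ce := row_mx C (- C1).
pose W := block_mx S 0 0 S1; pose Pe := block_mx S Pg Pg^T Phat.
have Sps := pd_psd _ _ _ Spd.
have Ws : W^T = W by rewrite /W tr_block_mx !trmx0 Ss /S1 trmx_ulsub Ss.
have Wpd : pd W by apply: pd_block_diag => //; exact: pd_ulsubmx.
have off_diag (a b : nat) (L : 'M[R]_a) (L' : 'M[R]_b) (F : 'I_m -> 'M[R]_a)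
    (F' : 'I_m -> 'M[R]_b) X X' :
    lyap (block_mx L 0 0 L') (fun k => block_mx (F k) 0 0 (F' k)) (block_mx X 0 0 X')
    = block_mx (lyap L F X) 0 0 (lyap L' F' X').
  rewrite lyap_block_diag !mulmx0 !mul0mx !addr0 !add0r.
  by congr block_mx; rewrite big1// => k _; rewrite mulmx0 mul0mx.
(* The first block is [B B^T]; the second inherits its sign from truncating the Gramian equation. *)
have LW : psd (- lyap Ae Ne W).
  rewrite off_diag opp_block_mx !oppr0; apply: psd_block_diag.
    by rewrite LS opprK -[X in X *m _]trmxK; exact: psd_trmx_mul.
  have := psd_ulsubmx_lyap _ _ _ _ A N S 0 Sur Sdl Sps.
  rewrite (_ : ulsubmx 0 = 0) ?subr0 ?subr0; last by apply/matrixP => i j; rewrite !mxE.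
  by apply; rewrite LS opprK -[X in X *m _]trmxK; exact: psd_trmx_mul.
(* The factor 2 absorbs the cross terms of [Ce^T Ce]: twice the block diagonal of [C^T C] and
   [C1^T C1], minus [Ce^T Ce], is the square [(C, C1)^T (C, C1)]. *)
have LZ : psd (- lyap Ae^T (fun k => (Ne k)^T) (2 *: W) - Ce^T *m Ce).
  have NeE : (fun k => (Ne k)^T) = (fun k => block_mx (N k)^T 0 0 (ulsubmx (N k)^T)).
    by apply/funext => k; rewrite /Ne tr_block_mx !trmx0 trmx_ulsub.
  have AeE : Ae^T = block_mx A^T 0 0 (ulsubmx A^T) by rewrite /Ae tr_block_mx !trmx0 trmx_ulsub.
  have CC : ulsubmx (C^T *m C) = C1^T *m C1.
    have CE : C^T *m C = block_mx (C1^T *m C1) (C1^T *m rsubmx C)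
        ((rsubmx C)^T *m C1) ((rsubmx C)^T *m rsubmx C).
      by rewrite -mul_col_row -tr_row_mx hsubmxK.
    by rewrite CE block_mxKul.
  have h : psd (- lyap (ulsubmx A^T) (fun k => ulsubmx (N k)^T) S1 - C1^T *m C1).
    rewrite -CC; apply: psd_ulsubmx_lyap => //.
    by rewrite LSt opprK subrr => v; rewrite /bform mulmx0 mul0mx mxE.
  rewrite lyapZ NeE AeE off_diag LSt.
  rewrite (_ : _ - _ = (row_mx C C1)^T *m row_mx C C1 + block_mx 0 0 0
    (2 *: (- lyap (ulsubmx A^T) (fun k => ulsubmx (N k)^T) S1 - C1^T *m C1))).
    apply: psd_addmx; first exact: psd_trmx_mul.
    apply: psd_block_diag; last exact: psd_scalemx.
    by move=> v; rewrite /bform mulmx0 mul0mx mxE.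
  move: (lyap (ulsubmx A^T) _ _) => L.
  rewrite /Ce !tr_row_mx !mul_col_row scale_block_mx !opp_block_mx !add_block_mx.
  rewrite !scaler0 !oppr0 [(- C1)^T]linearN/= !mulmxN !mulNmx !opprK; congr block_mx.
  - by rewrite scalerN opprK scaler_nat mulr2n addrK addr0.
  - by rewrite add0r addr0.
  - by rewrite add0r addr0.
  - by rewrite !scaler_nat !mulr2n; apply/matrixP => i j; rewrite !mxE; ring.
(* Blockwise these are the equations for [Sigma], for [P_g], for its transpose and for [Phat]. *)
have LPe : lyap Ae Ne Pe = - (Be *m Be^T).
  rewrite lyap_block_diag LS LPg /Be tr_col_mx mul_col_row opp_block_mx; congr block_mx => //.
  have := congr1 trmx LPg; rewrite !linearD/= linearN/= !trmx_mul !trmxK => <-.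
  rewrite [(A1 *m _) + _]addrC linear_sum/=; congr (_ + _).
  by apply: eq_bigr => k _; rewrite !trmx_mul trmxK mulmxA.
have xesol : bilinear_sol Ae Be Ne u (fun t => col_mx (x t) (xhat t)).
  exact: bilinear_sol_block.
have Zs : (2 *: W)^T = 2 *: W by rewrite linearZ/= Ws.
have Zpd : pd (2 *: W) by apply: pd_scalemx.
have := @output_bound R _ m p Ae W (2 *: W) Pe Be Ce Ne u _ t Ws Wpd LW Zs Zpd LZ LPe uL2 xesol t0.
have -> : Ce *m col_mx (x t) (xhat t) = C *m x t - lsubmx C *m xhat t.
  by rewrite mul_row_col mulNmx.
have -> : \tr (Ce *m Pe *m Ce^T) = \tr (drsubmx S *m K).
  rewrite -(@error_trace R m r s p m A N S B C Phat Pg Sur Sdl LS LSt LP LPg).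
  have tr_cross : \tr (C1 *m Pg^T *m C^T) = \tr (C *m Pg *m C1^T).
    by rewrite -mxtrace_tr !trmx_mul !trmxK mulmxA.
  rewrite /Ce /Pe mul_row_block tr_row_mx mul_row_col [(- C1)^T]linearN/= !mulmxN !mulNmx.
  rewrite mulmxDl !mulNmx mulmxBl opprB !(mxtraceN, mxtraceD) tr_cross; ring.
(* [N_{k,11}] vanishes with [N_k], so the error system has the same [u^0] as the full one. *)
have -> : (fun k => Ne k != 0) = (fun k => N k != 0).
  apply/funext => k; rewrite /Ne block_mx_eq0 !eqxx /= /N1.
  by have [->|//] := eqVneq (N k) 0; apply/negPn/eqP/matrixP => i j; rewrite !mxE.
set E := L2sq_sub _ u; set U := L2sq_sub _ u => bound.
have U0 : 0 <= U.
  by apply: sumr_ge0 => k _; rewrite fine_ge0// integral_ge0// => y _; rewrite lee_fin sqr_ge0.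
(* The bound so far is for the squared norm; its square root puts the half in the exponent. *)
have EE : expR (2^-1 * E) = Num.sqrt (expR E).
  apply/esym/eqP; rewrite -(eqrXn2 (n := 2))// ?sqrtr_ge0 ?expR_ge0//.
  by rewrite sqr_sqrtr ?expR_ge0// expr2 -expRD; apply/eqP; congr expR; lra.
rewrite EE -mulrA -sqrtrM ?expR_ge0// mulrC -sqrtrM ?mulr_ge0 ?expR_ge0// mulrC.
by rewrite /eucl ler_wsqrtr.
Qed.
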